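(* Let $G$ be a completely metrizable topological group, let $d$ be a left-invariant compatible metric on $G$, and let $T\colon G\to G$ be a continuous endomorphism of $G$. Then $T$ is either mean-L-stable or mean-L-unstable (with respect to $d$).
   Context: A topological group is completely metrizable if its topology is induced by some complete metric. A compatible metric $d$ on $G$ is a metric inducing the topology of $G$ (not required to be complete); it is left-invariant if $d(zx,zy)=d(x,y)$ for all $x,y,z\in G$. A continuous endomorphism is a continuous group homomorphism $G\to G$. $\mathbb{N}$ is the set of positive integers. For $A\subset\mathbb{N}$, the upper density is $\overline{\mathrm{dens}}(A)=\limsup_{n\to\infty}\frac{\mathrm{card}(A\cap[1,n])}{n}$. $T$ is mean-L-stable if for any $\varepsilon>0$ there exists $\delta>0$ such that for every $x,y\in G$ with $d(x,y)<\delta$, $\overline{\mathrm{dens}}(\{n\in\mathbb{N}: d(T^nx,T^ny)\ge\varepsilon\})<\varepsilon$. $T$ is mean-L-unstable if there exists $\delta>0$ such that for every $x\in G$ and $\varepsilon>0$ there exists $y\in G$ with $d(x,y)<\varepsilon$ such that $\overline{\mathrm{dens}}(\{n\in\mathbb{N}: d(T^nx,T^ny)>\delta\})\ge\delta$. *)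

(* Defs.v *)
From HB Require Import structures.
From mathcomp Require Import all_boot all_order all_algebra.
From mathcomp Require Import finmap.
From mathcomp Require Import all_classical all_reals all_analysis.

Set Implicit Arguments.
Unset Strict Implicit.
Unset Printing Implicit Defensive.

Import Order.TTheory GRing.Theory Num.Theory.

Local Open Scope classical_set_scope.
Local Open Scope ring_scope.

(* Multiplicative (not necessarily commutative) groups; the library only has
   the additive, commutative topologicalZmodType. *)
HB.mixin Record Group_Topological_isTopologicalGroup G
    & Group G & Topological G := {
  mulg_continuous : continuous (fun p : G * G => (p.1 * p.2)%g) ;
  invg_continuous : continuous (fun x : G => (x^-1)%g)
}.

#[short(type="topologicalGroupType")]
HB.structure Definition TopologicalGroup :=
  {G of Group G & Topological G & Group_Topological_isTopologicalGroup G}.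

Record is_metric (R : realType) (X : Type) (d : X -> X -> R) : Prop := IsMetric {
  metric_ge0 : forall x y, 0 <= d x y ;
  metric_eq0 : forall x y, d x y = 0 <-> x = y ;
  metric_symmetric : forall x y, d x y = d y x ;
  metric_triangular : forall x y z, d x z <= d x y + d y z
}.

Definition compatible_metric (R : realType) (X : topologicalType)
    (d : X -> X -> R) : Prop :=
  is_metric d /\
  forall (x : X) (A : set X),
    nbhs x A <-> exists2 e : R, 0 < e & [set y | d x y < e] `<=` A.

(* For a compatible metric, d-convergence is convergence in X. *)
Definition complete_metric (R : realType) (X : topologicalType)
    (d : X -> X -> R) : Prop :=
  forall u : nat -> X,
    (forall e : R, 0 < e -> exists N : nat, forall m n : nat,
       (N <= m)%N -> (N <= n)%N -> d (u m) (u n) < e) ->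
    exists l : X, u n @[n --> \oo] --> l.

Definition completely_metrizable (R : realType) (X : topologicalType) : Prop :=
  exists d : X -> X -> R, compatible_metric d /\ complete_metric d.

Definition left_invariant (R : realType) (G : groupType) (d : G -> G -> R) :
    Prop :=
  forall x y z : G, d (z * x)%g (z * y)%g = d x y.

(* Densities are of sets of positive integers: whether 0 \in A is irrelevant,
   and so is the junk value of the quotient at n = 0. *)
Definition upper_density (R : realType) (A : set nat) : \bar R :=
  limn_esup (fun n : nat =>
    ((#|` fset_set (A `&` [set k | (1 <= k <= n)%N])|)%:R / n%:R : R)%:E).

Definition mean_L_stable (R : realType) (X : Type) (d : X -> X -> R)
    (T : X -> X) : Prop :=
  forall e : R, 0 < e -> exists2 del : R, 0 < del &
    forall x y : X, d x y < del ->
      (upper_density R [set n | (e <= d (iter n T x) (iter n T y))%R] < e%:E)%E.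

Definition mean_L_unstable (R : realType) (X : Type) (d : X -> X -> R)
    (T : X -> X) : Prop :=
  exists2 del : R, 0 < del &
    forall (x : X) (e : R), 0 < e -> exists2 y : X, d x y < e &
      (del%:E <= upper_density R [set n | (del < d (iter n T x) (iter n T y))%R])%E.

(* Main.v *)
Require Import Defs.
From mathcomp Require Import all_boot all_order all_algebra.
From mathcomp Require Import finmap.
From mathcomp Require Import all_classical all_reals all_analysis.

Import Order.TTheory GRing.Theory Num.Theory.

Local Open Scope classical_set_scope.
Local Open Scope ring_scope.

(** The distance between two orbits depends only on the quotient of their
starting points: since [T] is an endomorphism and [d] is left-invariant,
[d (T^n a) (T^n b) = d (T^n (x a)) (T^n (x b))] for every [x]
([left_invariant_orbit]). Hence a pair [(a, b)] that witnesses a failure of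
stability at scale [e] can be moved, by the translation by [x a^-1], to a pair
[(x, x a^-1 b)] with any prescribed first point [x], without changing the
initial distance or the distances along the orbits. A failure of stability
somewhere is therefore a failure of stability everywhere, with the same scale
[e], and this is instability.

Stability bounds the density of [d >= e], while instability concerns the
density of [d > delta]. Monotonicity of the upper density
([le_upper_density]) bridges the two: halving [e] passes from the large
inequality to the strict one, and the converse inclusion, at equal constants,
makes stability and instability incompatible. *)

Lemma le_limf_esup {T : choiceType} {X : filteredType T} {R : realType}
    (f g : X -> \bar R) (F : set_system X) :
  (forall x, (f x <= g x)%E) -> (limf_esup f F <= limf_esup g F)%E.
Proof.
move=> fg; apply: le_ereal_inf_tmp => _ [V FV <-].
apply: (@le_trans _ _ (ereal_sup (f @` V))).
  by apply: ereal_inf_lbound; exists V.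
apply: ge_ereal_sup => _ [x Vx <-].
by apply: le_ereal_sup_tmp; exists (g x) => //; exists x.
Qed.

Lemma le_upper_density (R : realType) (A B : set nat) :
  A `<=` B -> (upper_density R A <= upper_density R B)%E.
Proof.
move=> AB; apply: le_limf_esup => n.
have fin C : finite_set (C `&` [set k | (1 <= k <= n)%N]).
  apply: (sub_finite_set _ (finite_II n.+1)) => k [_ /andP[_ kn]] /=.
  by rewrite ltnS.
rewrite lee_fin ler_wpM2r ?invr_ge0 ?ler0n// ler_nat.
by apply: fsubset_leq_card; rewrite -fset_set_sub//; exact: setSI.
Qed.

Lemma left_invariant_orbit (R : realType) (G : groupType) (d : G -> G -> R)
    (T : {multiplicative G -> G}) (z a b : G) (n : nat) :
  left_invariant d ->
  d (iter n T (z * a)%g) (iter n T (z * b)%g) = d (iter n T a) (iter n T b).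
Proof.
move=> dl; suff TM c : iter n T (z * c)%g = (iter n T z * iter n T c)%g.
  by rewrite !TM dl.
by elim: n => //= n ->; rewrite gmulfM.
Qed.

(** The two notions use opposite strictness conventions, so that at the same
constant the set controlled by instability lies inside the one controlled by
stability. *)
Lemma mean_L_stable_not_unstable (R : realType) (X : Type) (x : X)
    (d : X -> X -> R) (T : X -> X) :
  mean_L_stable d T -> ~ mean_L_unstable d T.
Proof.
move=> st [e e0 unst]; have [del del0 near] := st e e0.
have [y /near] := unst x del del0.
rewrite ltNge => /negP + le_e; apply; apply: (le_trans le_e).
by apply: le_upper_density => n /ltW.
Qed.

(** Left translation carries the single pair of points supplied by a failure of
stability to a pair based at any given point. *)
Lemma not_mean_L_stable_unstable (R : realType) (G : groupType)
    (d : G -> G -> R) (T : {multiplicative G -> G}) :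
  left_invariant d -> ~ mean_L_stable d T -> mean_L_unstable d T.
Proof.
move=> dl /existsNP[e /not_implyP[e0 nst]].
(* Halving turns the bound [e <= d] along the orbits into a strict one. *)
exists (e / 2) => [|x del del0]; first by rewrite divr_gt0.
have /existsNP[a /existsNP[b /not_implyP[ab /negP]]] :
    ~ forall a b, d a b < del ->
      (upper_density R [set n | (e <= d (iter n T a) (iter n T b))%R] < e%:E)%E.
  by move=> H; apply: nst; exists del.
rewrite -leNgt => dens.
(* [x] is the image of [a] under the translation by [x a^-1]. *)
have xE : x = (x * a^-1 * a)%g by rewrite mulgVK.
exists (x * a^-1 * b)%g; first by rewrite {1}xE dl.
apply: (@le_trans _ _ e%:E).
  by rewrite lee_fin ler_pdivrMr// ler_peMr ?ler1n// ltW.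
apply: (le_trans dens); apply: le_upper_density => n /= le_e.
rewrite {1}xE left_invariant_orbit//; apply: lt_le_trans le_e.
by rewrite ltr_pdivrMr// ltr_pMr// ltr1n.
Qed.

Theorem theorem5p13 (R : realType) (G : topologicalGroupType)
    (d : G -> G -> R) (T : {multiplicative G -> G}) :
  completely_metrizable R G ->
  compatible_metric d ->
  left_invariant d ->
  continuous T ->
  (mean_L_stable d T \/ mean_L_unstable d T) /\
  ~ (mean_L_stable d T /\ mean_L_unstable d T).
Proof.
move=> _ _ dl _; split.
  have [st|nst] := pselect (mean_L_stable d T); [by left|right].
  exact: not_mean_L_stable_unstable.
by move=> [st]; exact: (mean_L_stable_not_unstable _ _ 1%g).
Qed.
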